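(* Let $X$ and $Y$ be nonnegative absolutely continuous random variables with probability density functions $f$ and $g$, and cumulative distribution functions $F$ and $G$, respectively. If $X\le_{d}Y$ (dispersive order), then $CE_{\alpha}(X)\le CE_{\alpha}(Y)$ for all $\alpha>0$.
   Context: For a nonnegative random variable $X$ with support $(0,l)$, $0<l\le\infty$, and cumulative distribution function $F$, the fractional generalized cumulative entropy of order $\alpha>0$ is $$CE_{\alpha}(X)=\frac{1}{\Gamma(\alpha+1)}\int_{0}^{l}F(x)[-\ln F(x)]^{\alpha}\,dx,$$ provided the integral is finite (convention: the integrand is $0$ where $F(x)=0$). Dispersive order: $X\le_d Y$ means $F^{-1}(v)-F^{-1}(u)\le G^{-1}(v)-G^{-1}(u)$ for all $0<u\le v<1$, where $F^{-1}$ and $G^{-1}$ are the right-continuous inverses of $F$ and $G$. *)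

(* Defs.v *)
From HB Require Import structures.
From mathcomp Require Import all_boot all_order all_algebra.
From mathcomp Require Import all_classical all_reals all_analysis.
From mathcomp Require Import ess_sup_inf.

Set Implicit Arguments.
Unset Strict Implicit.
Unset Printing Implicit Defensive.

Import Order.TTheory GRing.Theory Num.Theory.
Import numFieldNormedType.Exports.

Local Open Scope classical_set_scope.
Local Open Scope ring_scope.

Definition Gamma (R : realType) (a : R) : R :=
  \int[@lebesgue_measure R]_(x in `]0, +oo[) (x `^ (a - 1) * expR (- x)).

Section random_variables.
Context d (T : measurableType d) (R : realType) (P : probability T R).
Implicit Type X : {RV P >-> R}.

Definition is_pdf X (f : R -> R) : Prop :=
  [/\ measurable_fun setT f,
      forall x, 0 <= f x &
      forall A, measurable A ->
        distribution P X A = (\int[lebesgue_measure]_(x in A) (f x)%:E)%E].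

Definition nonneg_rv X : Prop := \forall t \ae P, 0 <= X t.

(* If the support of X is the interval (0, l), 0 < l <= +oo, this is l. *)
Definition support_sup X : \bar R := ess_sup P (EFin \o X).

Definition cdfR X (x : R) : R := fine (cdf X x).

(* The value is +oo when the integral diverges.  The integrand vanishes where
   the cumulative distribution function does, whatever the value of ln 0. *)
Definition CE (alpha : R) X : \bar R :=
  (((Gamma (alpha + 1))^-1)%:E *
   \int[lebesgue_measure]_(x in [set x : R | 0 < x%:E < support_sup X])
     (cdfR X x * (- ln (cdfR X x)) `^ alpha)%:E)%E.

(* Right-continuous inverse of the cumulative distribution function.  It is
   meaningful for 0 < u < 1, where the set is nonempty and bounded below. *)
Definition rc_inverse X (u : R) : R := inf [set x : R | u < cdfR X x].

End random_variables.

Definition dispersive_le (R : realType)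
    (d1 d2 : measure_display)
    (T1 : measurableType d1) (T2 : measurableType d2)
    (P1 : probability T1 R) (P2 : probability T2 R)
    (X : {RV P1 >-> R}) (Y : {RV P2 >-> R}) : Prop :=
  forall u v : R, 0 < u -> u <= v -> v < 1 ->
    rc_inverse X v - rc_inverse X u <= rc_inverse Y v - rc_inverse Y u.

(* Main.v *)
Require Import Defs.
From HB Require Import structures.
From mathcomp Require Import all_boot all_order all_algebra.
From mathcomp Require Import all_classical all_reals all_analysis.
From mathcomp Require Import ess_sup_inf measurable_realfun.
From mathcomp Require Import ring lra.
Import Order.TTheory GRing.Theory Num.Theory.
Import numFieldNormedType.Exports.
Local Open Scope classical_set_scope.
Local Open Scope ring_scope.

(* Writing phi u = u (- ln u)^alpha, each CE is a nonnegative constant times the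
   integral of phi composed with a distribution function.  By the layer-cake
   formula it suffices to compare the lengths of {phi F > t} and {phi G > t}
   for t >= 0.  As phi is quasiconcave and vanishes at 0 and 1, {phi > t} is an
   interval inside (0, 1), and its preimage under F (resp. G) is an interval
   whose length is an increment of the inverse of F (resp. G); the dispersive
   order compares these increments. *)

(** * Layer-cake comparison of integrals *)

Section layer_cake.
Local Open Scope ereal_scope.
Context {d} {T : measurableType d} {R : realType}.
Variable mu : {sigma_finite_measure set T -> \bar R}.
Implicit Type h : T -> R.

Let leb : {measure set _ -> \bar R} := @lebesgue_measure R.

Lemma measurable_superlevel h t : measurable_fun setT h ->
  measurable [set x | (t < h x)%R].
Proof.
move=> mh; have := mh measurableT `]t, +oo[%classic (measurable_itv _).
rewrite setTI; congr measurable.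
by apply/seteqP; split => x /=; rewrite in_itv/= andbT.
Qed.

Lemma measurable_hypograph h : measurable_fun setT h ->
  measurable_fun setT
    ((fun p => (\1_`[0%R, h p.1[ p.2)%:E) : T * measurableTypeR R -> \bar R).
Proof.
move=> mh; apply/measurable_EFinP/measurable_indic => /=.
pose fsnd (p : T * measurableTypeR R) := (0 <= p.2)%R.
pose f21 (p : T * measurableTypeR R) := (p.2 < h p.1)%R.
rewrite [X in measurable X](_ : _ =
    fsnd @^-1` [set true] `&` f21 @^-1` [set true]); last first.
  by apply/seteqP; split => p; rewrite in_itv/= => /andP.
apply: measurableI.
- have : measurable_fun setT fsnd by exact: measurable_fun_ler.
  by move=> /(_ measurableT [set true]); rewrite setTI; exact.
- have : measurable_fun setT f21.
    by apply: measurable_fun_ltr => //; exact: measurableT_comp.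
  by move=> /(_ measurableT [set true]); rewrite setTI; exact.
Qed.

(** As [h x] is the length of [[0, h x[], both sides are the product measure of the region under the
    graph, sliced along either axis (Tonelli). *)
Lemma ge0_integral_hypograph h :
  measurable_fun setT h -> (forall x, 0 <= h x)%R ->
  \int[mu]_x (h x)%:E = \int[leb]_s \int[mu]_x (\1_`[0%R, h x[ s : R)%:E.
Proof.
move=> mh h0.
transitivity (\int[mu]_x \int[leb]_s (\1_`[0%R, h x[ s : R)%:E).
  apply: eq_integral => x _.
  rewrite integral_indic//= setIT lebesgue_measure_itv/= lte_fin.
  case: ltP => [_|hx]; first by rewrite EFinN sube0.
  by apply/eqP; rewrite eqe eq_le hx h0.
rewrite (fubini_tonelli
  (fun p : T * measurableTypeR R => (\1_`[0%R, h p.1[ p.2 : R)%:E))//=.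
exact: measurable_hypograph.
Qed.

(** After slicing by height, the slice at [s >= 0] is the superlevel set at [s], and the slices at
    [s < 0] are empty. The outer integrands then compare pointwise. *)
Lemma le_integral_superlevel h1 h2 :
  measurable_fun setT h1 -> (forall x, 0 <= h1 x)%R ->
  measurable_fun setT h2 -> (forall x, 0 <= h2 x)%R ->
  (forall t, (0 <= t)%R -> mu [set x | t < h1 x]%R <= mu [set x | t < h2 x]%R) ->
  \int[mu]_x (h1 x)%:E <= \int[mu]_x (h2 x)%:E.
Proof.
move=> mh1 h10 mh2 h20 h12; rewrite !ge0_integral_hypograph//.
have E h : measurable_fun setT h -> forall s,
    \int[mu]_x (\1_`[0%R, h x[ s : R)%:E =
    if (0 <= s)%R then mu [set x | s < h x]%R else 0.
  move=> mh s; case: ifPn => s0.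
    have mA := measurable_superlevel _ s mh.
    rewrite -[X in _ = mu X]setIT -integral_indic//.
    apply: eq_integral => x _; rewrite !indicE; congr (_%:E).
    rewrite (_ : (s \in _) = (x \in [set x | (s < h x)%R]))//.
    by apply/idP/idP; rewrite !inE/= in_itv/= s0.
  apply: integral0_eq => x _.
  by rewrite indicE memNset//= in_itv/= (negbTE s0).
apply: ge0_le_integral => //.
- move=> s _; exact: integral_ge0.
- apply: (measurable_fun_fubini_tonelli_G _ (measurable_hypograph _ mh1)) => x.
  by rewrite lee_fin.
- apply: (measurable_fun_fubini_tonelli_G _ (measurable_hypograph _ mh2)) => x.
  by rewrite lee_fin.
- by move=> s _; rewrite !E//; case: ifPn => // s0; exact: h12.
Qed.
End layer_cake.

(** * The function sending u to u (- ln u)^a on [0, 1] *)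

Section quasiconcave.
Context {R : realType}.
Implicit Types a u v w t : R.

Lemma mulr_powR_lnN_expR a u : 0 < u < 1 ->
  u * (- ln u) `^ a = expR (ln u + a * ln (- ln u)).
Proof.
move=> u01; have /andP[u0 u1] := u01.
have L : 0 < - ln u by rewrite oppr_gt0 ln_lt0.
by rewrite /powR gt_eqF// expRD lnK.
Qed.

(** Concavity of the logarithm: ln (1 + z) <= z at z = y / x - 1. *)
Lemma ler_ln_div (x y : R) : 0 < x -> 0 < y -> ln y - ln x <= y / x - 1.
Proof.
move=> x0 y0; rewrite -ln_div ?posrE//.
have := @le_ln1Dx _ (y / x - 1); rewrite addrCA subrr addr0; apply.
by rewrite ltrBDl addrN divr_gt0.
Qed.

(* The function s |-> a ln s - s is unimodal with its maximum at s = a. *)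
Lemma ler_mulr_lnB a (x y : R) : 0 < a -> 0 < x -> 0 < y ->
  (a - x) * (y - x) <= 0 -> a * ln y - y <= a * ln x - x.
Proof.
move=> a0 x0 y0 axy.
(* The tangent bound gives at most a (y - x) / x, and the sign hypothesis says exactly that a (y -
   x) <= x (y - x). *)
have : a * (ln y - ln x) <= y - x.
  apply: (le_trans (ler_wpM2l (ltW a0) (ler_ln_div _ _ x0 y0))).
  have -> : y / x - 1 = (y - x) / x by field; rewrite gt_eqF.
  by rewrite mulrA ler_pdivrMr//; lra.
lra.
Qed.

(** With s = - ln u, the logarithm of the function is a ln s - s, which is unimodal; the
    substitution is monotone, so quasiconcavity carries over. *)
Lemma quasiconcave_mulr_powR_lnN a u v w t :
  0 < a -> 0 < u -> u <= w -> w <= v -> v < 1 ->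
  t < u * (- ln u) `^ a -> t < v * (- ln v) `^ a -> t < w * (- ln w) `^ a.
Proof.
move=> a0 u0 uw wv v1.
have w0 := lt_le_trans u0 uw; have v0 := lt_le_trans w0 wv.
have w1 := le_lt_trans wv v1; have u1 := le_lt_trans uw w1.
rewrite !mulr_powR_lnN_expR ?u0 ?v0 ?w0// => tu tv.
have Lu : 0 < - ln u by rewrite oppr_gt0 ln_lt0// u0.
have Lw : 0 < - ln w by rewrite oppr_gt0 ln_lt0// w0.
have Lv : 0 < - ln v by rewrite oppr_gt0 ln_lt0// v0.
have luw : ln u <= ln w by rewrite ler_ln.
have lwv : ln w <= ln v by rewrite ler_ln.
(* The peak is at s = a. Whichever side of it [- ln w] lies on, one of [v], [u] is farther from the
   peak on that same side, so its value is at most the value at [w]. *)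
have [aw|/ltW aw] := leP (- ln w) a.
- apply: (lt_le_trans tv); rewrite ler_expR.
  suff : (a - - ln w) * (- ln v - - ln w) <= 0.
    by move/(ler_mulr_lnB _ _ _ a0 Lw Lv); lra.
  by apply: mulr_ge0_le0; lra.
- apply: (lt_le_trans tu); rewrite ler_expR.
  suff : (a - - ln w) * (- ln u - - ln w) <= 0.
    by move/(ler_mulr_lnB _ _ _ a0 Lw Lu); lra.
  by apply: mulr_le0_ge0; lra.
Qed.

(** The exponential form is continuous at [u], so a strict inequality there persists slightly to the
    left. *)
Lemma mulr_powR_lnN_left_open a u t : 0 < u < 1 ->
  t < u * (- ln u) `^ a -> exists2 v, 0 < v < u & t < v * (- ln v) `^ a.
Proof.
move=> u01 tu; have /andP[u0 u1] := u01.
rewrite mulr_powR_lnN_expR// in tu.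
pose f x := expR (ln x + a * ln (- ln x)).
have lnNln : {for u, continuous (fun x => ln (- ln x))}.
  apply: (@continuous_comp _ _ _ (fun x => - ln x)).
    by apply: cvgN; exact: continuous_ln.
  by apply: continuous_ln; rewrite oppr_gt0 ln_lt0.
have fu : f x @[x --> u] --> f u.
  apply: (@continuous_comp R R R (fun x => ln x + a * ln (- ln x)) expR);
    last exact: continuous_expR.
  apply: cvgD; first exact: continuous_ln.
  by apply: cvgM; first exact: cvg_cst.
have : \forall x \near u^'-, 0 < x < u /\ t < f x.
  near=> x; split; last first.
    by near: x; apply: cvgr_gt tu; exact: cvg_at_left_filter.
  by apply/andP; split; near: x; [exact: nbhs_left_gt|exact: nbhs_left_lt].
move=> /filter_ex[x [/andP[x0 xu] tx]]; exists x; first by rewrite x0.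
by rewrite mulr_powR_lnN_expR// x0 (lt_trans xu).
Unshelve. all: by end_near.
Qed.

Lemma measurable_mulr_powR_lnN a :
  measurable_fun setT (fun u : R => u * (- ln u) `^ a).
Proof.
apply: measurable_funM; first exact: measurable_id.
apply: (@measurableT_comp _ _ _ _ _ _ (@powR R ^~ a) _ (fun u => - ln u)).
  exact: measurable_powR.
exact: measurable_funN (@measurable_ln R).
Qed.

(** The function vanishes at 0 through its first factor and at 1 because 0^a = 0 for a > 0. *)
Lemma mulr_powR_lnN_gt0 a u : 0 < a -> 0 <= u <= 1 ->
  0 < u * (- ln u) `^ a -> 0 < u < 1.
Proof.
move=> a0 /andP[]; rewrite !le_eqVlt => /predU1P[<-|u0].
  by rewrite mul0r ltxx.
move=> /predU1P[->|u1]; last by rewrite u0 u1.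
rewrite ln1 oppr0 powR0 ?gt_eqF// mulr0.
by move/lt_eqF; rewrite eqxx.
Qed.
End quasiconcave.

(** * Distribution functions and their right-continuous inverses *)

Definition CE_integrand {d} {T : measurableType d} {R : realType}
    {P : probability T R} (X : {RV P >-> R}) (alpha x : R) : R :=
  cdfR X x * (- ln (cdfR X x)) `^ alpha.

Section cdfR.
Context {d} {T : measurableType d} {R : realType} {P : probability T R}.
Variable X : {RV P >-> R}.

Lemma cdfR_ge0 x : 0 <= cdfR X x.
Proof. by rewrite fine_ge0// cdf_ge0. Qed.

Lemma cdfR_le1 x : cdfR X x <= 1.
Proof. by rewrite -lee_fin fineK ?fin_num_measure// cdf_le1. Qed.

Lemma cdfR_nondecreasing : nondecreasing_fun (cdfR X).
Proof. by move=> x y xy; rewrite fine_le ?fin_num_measure// cdf_nondecreasing. Qed.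

Lemma measurable_cdfR : measurable_fun setT (cdfR X).
Proof. by apply: nondecreasing_measurable => //; exact: cdfR_nondecreasing. Qed.

Lemma measurable_CE_integrand alpha : measurable_fun setT (CE_integrand X alpha).
Proof.
exact: (measurableT_comp (measurable_mulr_powR_lnN alpha) measurable_cdfR).
Qed.

Lemma measurable_CE_integrand_superlevel alpha t :
  measurable [set x | t < CE_integrand X alpha x].
Proof. exact: (measurable_superlevel _ t (measurable_CE_integrand alpha)). Qed.

Lemma CE_integrand_ge0 alpha x : 0 <= CE_integrand X alpha x.
Proof. by rewrite mulr_ge0 ?cdfR_ge0 ?powR_ge0. Qed.

Lemma CE_integrand_gt0 alpha x :
  0 < alpha -> 0 < CE_integrand X alpha x -> 0 < cdfR X x < 1.
Proof.
by move=> alpha0; apply: mulr_powR_lnN_gt0 => //; rewrite cdfR_ge0 cdfR_le1.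
Qed.

Lemma cdfR_lt0 x : nonneg_rv X -> x < 0 -> cdfR X x = 0.
Proof.
move=> [N [mN PN0 XN]] x0; rewrite /cdfR /cdf /distribution /pushforward.
rewrite (@subset_measure0 _ _ _ P _ N)//; first exact: measurable_funPTI.
move=> t /=; rewrite in_itv/= => Xt; apply: XN => /=; apply/negP.
by rewrite -ltNge (le_lt_trans Xt).
Qed.

(** The event X <= x contains the complement of a null set. Contrapositively, a point where the
    distribution function is below 1 lies below the support bound. *)
Lemma cdfR_ge_support_sup x : (support_sup X <= x%:E)%E -> cdfR X x = 1.
Proof.
move=> /ess_supP [N [mN PN0 XN]].
rewrite /cdfR; suff -> : cdf X x = 1%E by [].
apply/eqP; rewrite eq_le cdf_le1/= /cdf /distribution /pushforward.
have <- : P (~` N) = 1%E by rewrite probability_setC// PN0 sube0.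
apply: le_measure; rewrite ?inE//; first exact: measurableC.
  exact: measurable_funPTI.
move=> t Nt /=; rewrite in_itv/= -lee_fin; apply: contrapT => h.
by apply: Nt; apply: XN.
Qed.

Lemma cdfR_gt u : u < 1 -> exists x, u < cdfR X x.
Proof.
move=> u1; have /fine_cvgP[_ F1] := @cvg_cdfy1 _ _ _ _ X.
exact: filter_ex (cvgr_gt _ F1 _ u1).
Qed.

Hypothesis X_ge0 : nonneg_rv X.

(** Ensures that the [inf] in [rc_inverse] is a genuine infimum and not a default value;
    nonnegativity of the variable supplies the lower bound 0. *)
Lemma has_inf_rc_inverse u : 0 <= u < 1 -> has_inf [set x : R | u < cdfR X x].
Proof.
move=> /andP[u0 u1]; split; first exact: cdfR_gt.
exists 0 => x /=; rewrite leNgt => ux; apply/negP => x0.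
by move: ux; rewrite cdfR_lt0// ltNge u0.
Qed.

Lemma rc_inverse_ge0 u : 0 <= u < 1 -> 0 <= rc_inverse X u.
Proof.
move=> u01; have [S0 _] := has_inf_rc_inverse _ u01.
apply: lb_le_inf => // x /=; rewrite leNgt => ux; apply/negP => x0.
by move: ux; rewrite cdfR_lt0// ltNge; case/andP: u01 => ->.
Qed.

(** The hypothesis on [x] is strict because at the infimum itself the distribution function may
    equal [u]. *)
Lemma cdfR_gt_rc_inverse u x : 0 <= u < 1 -> rc_inverse X u < x -> u < cdfR X x.
Proof.
move=> u01 ux; have [S0 _] := has_inf_rc_inverse _ u01.
have [y /= uy yx] := inf_lt S0 ux.
by rewrite (lt_le_trans uy)// cdfR_nondecreasing// ltW.
Qed.

Lemma rc_inverse_le u x : 0 <= u < 1 -> u < cdfR X x -> rc_inverse X u <= x.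
Proof. by move=> u01 ux; apply: ge_inf => //; case: (has_inf_rc_inverse _ u01). Qed.

Lemma le_rc_inverse u x : 0 <= u < 1 -> cdfR X x <= u -> x <= rc_inverse X u.
Proof.
move=> u01 xu; have [S0 _] := has_inf_rc_inverse _ u01.
apply: lb_le_inf => // y /= uy; rewrite leNgt; apply/negP => yx.
by have := cdfR_nondecreasing _ _ (ltW yx); rewrite leNgt (le_lt_trans xu).
Qed.

End cdfR.

(** * Lengths of superlevel sets under the dispersive order *)

(** A set of finite diameter sits in [[inf A, sup A]], whose length is that diameter. This allows a
    superlevel set to be bounded through pairs of its points, without computing its endpoints. *)
Lemma lebesgue_measure_le_diameter (R : realType) (A : set R) (M : \bar R) :
  measurable A -> (0 <= M)%E ->
  (forall x y, A x -> A y -> x <= y -> ((y - x)%:E <= M)%E) ->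
  (lebesgue_measure A <= M)%E.
Proof.
move=> mA; case: M => [M| |]//; last by move=> _ _; rewrite leey.
rewrite lee_fin => M0 AM.
have [->|/set0P[x0 Ax0]] := eqVneq A set0; first by rewrite measure0 lee_fin.
have {}AM x y : A x -> A y -> y - x <= M.
  move=> Ax Ay; have [xy|/ltW yx] := leP x y; first by rewrite -lee_fin AM.
  by rewrite (le_trans _ M0)// subr_le0.
have hlb : has_lbound A by exists (x0 - M) => y Ay; have := AM _ _ Ay Ax0; lra.
have hub : has_ubound A by exists (x0 + M) => y Ay; have := AM _ _ Ax0 Ay; lra.
have sub : A `<=` `[inf A, sup A].
  by move=> x Ax /=; rewrite in_itv/= ge_inf//= ub_le_sup.
apply: (@le_trans _ _ (lebesgue_measure `[inf A, sup A])).
  by apply: le_measure; rewrite ?inE.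
rewrite lebesgue_measure_itv/= lte_fin; case: ifP => _; last by rewrite lee_fin.
rewrite lee_fin lerBlDr; apply: ge_sup; first by exists x0.
move=> y Ay; rewrite -lerBlDl; apply: lb_le_inf; first by exists x0.
by move=> x Ax; have := AM _ _ Ax Ay; lra.
Qed.

Lemma measurable_support_itv (R : realType) (l : \bar R) :
  measurable [set x : R | (0 < x%:E < l)%E].
Proof.
apply: is_interval_measurable => x y /= /andP[x0 xl] /andP[y0 yl] z /andP[xz zy].
by rewrite (lt_le_trans x0) ?lee_fin//= (le_lt_trans _ yl) ?lee_fin.
Qed.

(* The level [w], strictly below that of [x], absorbs a flat piece of the
   distribution function at [x]: [rc_inverse] returns its right end. *)
Lemma dispersive_le_superlevel {R : realType}
    {d1 d2 : measure_display}
    {T1 : measurableType d1} {T2 : measurableType d2}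
    {P1 : probability T1 R} {P2 : probability T2 R}
    {X : {RV P1 >-> R}} {Y : {RV P2 >-> R}} {alpha t : R} :
  nonneg_rv X -> nonneg_rv Y -> dispersive_le X Y -> 0 < alpha -> 0 <= t ->
  (lebesgue_measure [set x | (t < CE_integrand X alpha x)%R] <=
   lebesgue_measure ([set x : R | (0 < x%:E < support_sup Y)%E] `&`
                     [set x | (t < CE_integrand Y alpha x)%R]))%E.
Proof.
move=> X0 Y0 XY alpha0 t0.
apply: lebesgue_measure_le_diameter => [|//|x y /= tx ty xy].
  exact: measurable_CE_integrand_superlevel.
have u01 := CE_integrand_gt0 _ _ _ alpha0 (le_lt_trans t0 tx).
have /andP[v0 v1] := CE_integrand_gt0 _ _ _ alpha0 (le_lt_trans t0 ty).
have uv := cdfR_nondecreasing X _ _ xy.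
have [w /andP[w0 wu] tw] := mulr_powR_lnN_left_open _ _ _ u01 tx.
set v := cdfR X y in v0 v1 uv *.
have wv : w <= v := ltW (lt_le_trans wu uv).
have w01 : 0 <= w < 1 by rewrite (ltW w0) (le_lt_trans wv).
have v01 : 0 <= v < 1 by rewrite (ltW v0).
have xw : rc_inverse X w <= x by apply: rc_inverse_le.
have yv : y <= rc_inverse X v by apply: le_rc_inverse.
have := XY w v w0 wv v1.
set p := rc_inverse Y w; set q := rc_inverse Y v => Ypq.
(* By the dispersive order, q - p is at least the corresponding increment for [X], which is at least
   y - x since [xw] and [yv] enclose [x, y]. *)
apply: (@le_trans _ _ (lebesgue_measure `]p, q[%classic)).
  rewrite lebesgue_measure_itv/= lte_fin; case: ltP => pq.
    by rewrite -EFinB lee_fin; lra.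
  by rewrite lee_fin; lra.
apply: le_measure; rewrite ?inE//.
  apply: measurableI; first exact: measurable_support_itv.
  exact: measurable_CE_integrand_superlevel.
(* Between [p] and [q] the distribution function of [Y] takes values in ]w, v], where quasiconcavity
   keeps the integrand above [t]; as v < 1 and p >= 0, such points also lie in the support
   interval. *)
move=> z /=; rewrite in_itv/= => /andP[pz zq].
have wz : w < cdfR Y z by apply: cdfR_gt_rc_inverse.
have zv : cdfR Y z <= v.
  by rewrite leNgt; apply/negP => /(rc_inverse_le Y Y0 _ _ v01); rewrite leNgt zq.
split; last first.
  exact: (quasiconcave_mulr_powR_lnN _ _ _ _ _ alpha0 w0 (ltW wz) zv v1 tw ty).
rewrite lte_fin (le_lt_trans _ pz)/= ?rc_inverse_ge0// ltNge; apply/negP.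
by move=> /cdfR_ge_support_sup z1; move: zv; rewrite z1 leNgt v1.
Qed.

Theorem theorem3p1 (R : realType)
    (d1 d2 : measure_display)
    (T1 : measurableType d1) (T2 : measurableType d2)
    (P1 : probability T1 R) (P2 : probability T2 R)
    (X : {RV P1 >-> R}) (Y : {RV P2 >-> R})
    (f g : R -> R)
    (X_ge0 : nonneg_rv X) (Y_ge0 : nonneg_rv Y)
    (X_pdf : is_pdf X f) (Y_pdf : is_pdf Y g)
    (XY : dispersive_le X Y) :
  forall alpha : R, 0 < alpha -> (CE alpha X <= CE alpha Y)%E.
Proof.
move=> alpha alpha0; apply: lee_wpmul2l.
  rewrite lee_fin invr_ge0; apply: Rintegral_ge0 => x _.
  by rewrite mulr_ge0 ?powR_ge0 ?expR_ge0.
(* Extending by 0 off the support interval puts both integrals on the whole line, as the layer-cake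
   comparison requires. *)
have restrictE (D : set R) (h : R -> R) :
    (\int[lebesgue_measure]_(x in D) (h x)%:E =
     \int[lebesgue_measure]_x ((h \_ D) x)%:E)%E.
  rewrite integral_mkcond; apply: eq_integral => x _.
  by rewrite !patchE; case: ifP.
rewrite -!/(CE_integrand _ _ _) (restrictE _ (CE_integrand X alpha)).
rewrite (restrictE _ (CE_integrand Y alpha)).
(* The condition 0 <= t excludes the points off [D], where the extended function is 0. *)
have superlevelE d (T : measurableType d) (P : probability T R)
    (Z : {RV P >-> R}) (D : set R) t : 0 <= t ->
    [set x | t < (CE_integrand Z alpha \_ D) x] =
    D `&` [set x | t < CE_integrand Z alpha x].
  move=> t0; apply/seteqP; split => x /=; rewrite patchE; case: ifPn.
  - by rewrite inE.
  - by rewrite ltNge t0.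
  - by move=> _ [].
  - by rewrite notin_setE => nDx [].
apply: le_integral_superlevel.
- apply/(measurable_restrictT _ (measurable_support_itv _ _)).
  by apply: measurable_funTS; exact: measurable_CE_integrand.
- by move=> x; rewrite patchE; case: ifP => // _; exact: CE_integrand_ge0.
- apply/(measurable_restrictT _ (measurable_support_itv _ _)).
  by apply: measurable_funTS; exact: measurable_CE_integrand.
- by move=> x; rewrite patchE; case: ifP => // _; exact: CE_integrand_ge0.
- move=> t t0; rewrite !superlevelE//.
  (* On the [X] side the support constraint is dropped, which only enlarges the set. *)
  apply: le_trans (dispersive_le_superlevel X_ge0 Y_ge0 XY alpha0 t0).
  apply: le_measure; rewrite ?inE//.
    apply: measurableI; first exact: measurable_support_itv.
    exact: measurable_CE_integrand_superlevel.
  exact: measurable_CE_integrand_superlevel.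
Qed.
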